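(* Let $r,n,m,k$ be positive integers with $\mathrm{Inc}_k((n,m)/(r))\neq\emptyset$. Then $$\sum_{T\in\mathrm{Inc}_k((n,m)/(r))}q^{\mathrm{maj}(T)}=q^{\frac{k(k-1)}{2}}\left[{n+m-k-r\atop k}\right]\left(\left[{n+m-2k-r\atop m-k}\right]-\frac{q^n[k]+[n][m-r]}{[n][n+1]}\left[{n+m-2k-r\atop n-k}\right]\right).$$
   Context: Tableaux are drawn in English notation (row 1 on top). An increasing tableau of skew shape $\lambda/\mu$ (with $\lambda\supseteq\mu$ partitions) is a filling of the boxes of $\lambda/\mu$ by positive integers that is strictly increasing along rows (left to right) and strictly increasing down columns, and whose set of entries is an initial segment $\{1,2,\dots,N\}$ of the positive integers. $\mathrm{Inc}_k(\lambda/\mu)$ is the set of increasing tableaux of shape $\lambda/\mu$ with maximal entry $|\lambda/\mu|-k$. Here $\lambda=(n,m)$ (so $n\ge m$) and $\mu=(r)$ (so $r\le n$), and $|\lambda/\mu|=n+m-r$. A descent of a tableau $T$ is an integer $i$ such that some occurrence of $i$ in $T$ lies in a row strictly above the row of some occurrence of $i+1$; $\mathrm{maj}(T)$ is the sum of all descents of $T$ (each counted once). For an integer $a$, $[a]=\frac{1-q^a}{1-q}$; for $a\ge 0$, $[a]!=[1][2]\cdots[a]$; $\left[{a\atop b}\right]=\frac{[a]!}{[b]!\,[a-b]!}$ is the $q$-binomial coefficient, which is $0$ if $b<0$ or $b>a$. *)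

(* Defs.v *)
From HB Require Import structures.
From mathcomp Require Import all_boot all_order all_algebra.

Set Implicit Arguments.
Unset Strict Implicit.
Unset Printing Implicit Defensive.

Import GRing.Theory.

(* Partitions are weakly decreasing sequences of positive naturals, padded
   with zeros.  Rows and columns are numbered from 0, row 0 being the top one,
   so box (i, j) lies in la/mu iff mu_i <= j < la_i; the columns of la are
   bounded by its largest part [head 0 la]. *)
Definition in_skew (la mu : seq nat) (b : 'I_(size la) * 'I_(head 0 la)) : bool :=
  nth 0 mu b.1 <= b.2 < nth 0 la b.1.

Notation box la mu := {b | @in_skew la mu b}.

Section Tableaux.
Variables la mu : seq nat.

Definition row (b : box la mu) : nat := (val b).1.
Definition col (b : box la mu) : nat := (val b).2.

(* The entries of an increasing tableau form an initial segment 1, ..., N of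
   the positive integers, so N is at most the number of boxes; bounding the
   entries by #|box la mu| thus loses nothing. *)
Definition filling : Type := {ffun box la mu -> 'I_#|{: box la mu}|.+1}.
HB.instance Definition _ := Finite.on filling.

Definition entry (T : filling) (b : box la mu) : nat := (T : {ffun _ -> _}) b.

Definition has_entry (T : filling) (v : nat) : bool :=
  [exists b, entry T b == v].

Definition max_entry (T : filling) : nat := \max_b entry T b.

Definition increasing_tableau (T : filling) : bool :=
  [&& [forall b, 0 < entry T b],
      [forall b, forall c,
         (row b == row c) && (col b < col c) ==> (entry T b < entry T c)],
      [forall b, forall c,
         (col b == col c) && (row b < row c) ==> (entry T b < entry T c)]
    & [forall v : 'I_(max_entry T).+1, (0 < v) ==> has_entry T v]].

Definition descent (T : filling) (i : nat) : bool :=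
  [exists b, exists c,
     [&& entry T b == i, entry T c == i.+1 & row b < row c]].

Definition maj (T : filling) : nat :=
  \sum_(0 <= i < (max_entry T).+1 | descent T i) i.

(* [max_entry T + k = |la/mu|] avoids truncated subtraction. *)
Definition Inc (k : nat) : {set filling} :=
  [set T | increasing_tableau T & max_entry T + k == #|{: box la mu}|].

End Tableaux.

Section QAnalogues.
Local Open Scope ring_scope.
Variables (F : fieldType) (q : F).

Definition qint (a : int) : F := (1 - q ^ a) / (1 - q).

Definition qfact (a : nat) : F := \prod_(1 <= i < a.+1) qint i.

(* [`|a|%N] only converts nonnegative integers to nat here. *)
Definition qbinom (a b : int) : F :=
  if (0 <= b <= a) then qfact `|a|%N / (qfact `|b|%N * qfact `|(a - b)%R|%N)
  else 0.

End QAnalogues.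

(* The indeterminate of the field of rational functions in q over the
   rationals. *)
Definition qX : {fraction {poly rat}} := tofrac 'X%R.

(* Main.v *)
(* Recording for each entry v = 1, ..., N whether it lies in row 1 only (U), in
   row 2 only (D) or in both rows (X) identifies the tableaux with the words in
   a = n-r-k letters U, b = m-k letters D and k letters X such that every D or X
   is preceded by fewer D's than r plus the number of U's.  Removing the last
   letter gives recurrences for the generating function of these words by maj,
   jointly with that of the words ending in D, since the last letter decides
   whether appending a D or an X creates a descent.  Both have closed forms, a
   term for unrestricted words minus a correction, satisfying the same
   recurrences and the same condition on the line b = r + a. *)

From HB Require Import structures.
From mathcomp Require Import all_boot all_order all_algebra.
From mathcomp Require Import ring zify.
Require Import Defs.

Set Implicit Arguments.
Unset Strict Implicit.
Unset Printing Implicit Defensive.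

Import Order.TTheory GRing.Theory Num.Theory.
Local Open Scope ring_scope.

(** * Closed forms and their recurrences *)

Section QIdentities.
Variables (F : fieldType) (q : F).
Hypothesis q_generic : forall i, (0 < i)%N -> q ^+ i != 1.

(** The symbol $(q;q)_n$. It stands in for the $q$-factorial because the powers of $1-q$ cancel in
    $q$-binomials and $q$-trinomials. *)
Definition qpoch (n : nat) : F := \prod_(i < n) (1 - q ^+ i.+1).

Definition qtrinom (a b k : nat) : F :=
  qpoch (a + b + k) / (qpoch a * qpoch b * qpoch k).

Definition qtri (k : nat) : F := q ^+ 'C(k, 2).

Lemma subr1X_neq0 i : (0 < i)%N -> 1 - q ^+ i != 0.
Proof. by move=> i_gt0; rewrite subr_eq0 eq_sym q_generic. Qed.

Lemma qpochS n : qpoch n.+1 = qpoch n * (1 - q ^+ n.+1).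
Proof. by rewrite /qpoch big_ord_recr. Qed.

Lemma qpoch_neq0 n : qpoch n != 0.
Proof. by apply/prodf_neq0 => i _; apply: subr1X_neq0. Qed.

Lemma qtriS k : qtri k.+1 = qtri k * q ^+ k.
Proof. by rewrite /qtri binS bin1 addnC exprD mulrC. Qed.

Lemma qtrinomS1 a b k : qtrinom a.+1 b k * (1 - q ^+ a.+1) =
  qtrinom a b k * (1 - q ^+ (a + b + k).+1).
Proof.
rewrite /qtrinom !addSn !qpochS.
have := (qpoch_neq0 a, qpoch_neq0 b, qpoch_neq0 k, subr1X_neq0 (ltn0Sn a)).
by move=> [] [] [] ? ? ? ?; field; apply/and4P.
Qed.

Lemma qtrinomC a b k : qtrinom a b k = qtrinom b a k.
Proof. by rewrite /qtrinom [(a + b)%N]addnC [qpoch a * _]mulrC. Qed.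

Lemma qtrinomS2 a b k : qtrinom a b.+1 k * (1 - q ^+ b.+1) =
  qtrinom a b k * (1 - q ^+ (a + b + k).+1).
Proof. by rewrite qtrinomC qtrinomS1 qtrinomC [(b + a)%N]addnC. Qed.

Lemma qtrinomS3 a b k : qtrinom a b k.+1 * (1 - q ^+ k.+1) =
  qtrinom a b k * (1 - q ^+ (a + b + k).+1).
Proof.
rewrite /qtrinom !addnS !qpochS.
have := (qpoch_neq0 a, qpoch_neq0 b, qpoch_neq0 k, subr1X_neq0 (ltn0Sn k)).
by move=> [] [] [] ? ? ? ?; field; apply/and4P.
Qed.

(** The closed form for words with no ballot condition; [freeD_gf] is its analogue for those ending
    in D. There the last ratio turns [qtrinom a b k] into the trinomial with one D fewer, and makes
    the value 0 when [b = 0]. *)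
Definition free_gf (a b k : nat) : F := qtri k * qtrinom a b k.

Definition freeD_gf (a b k : nat) : F :=
  qtri k * q ^+ (a + k) * qtrinom a b k
  * ((1 - q ^+ b) / (1 - q ^+ (a + b + k))).

(* The number of D's enters the correction only through its excess c over r,
   and r itself only through s = a + r. *)
Definition bad_gf (s c k : nat) : F :=
  qtri k * qtrinom s c k *
  ((1 - q ^+ k) / (1 - q ^+ (s + k))
   + q ^+ k * (1 - q ^+ c) / (1 - q ^+ (s + k).+1)).

Definition badD_gf (s c k : nat) : F :=
  qtri k * q ^+ (s + k) * qtrinom s c k
  * ((1 - q ^+ c) / (1 - q ^+ (s + c + k)))
  * ((1 - q ^+ k) / (1 - q ^+ (s + k))
     + q ^+ k * (q - q ^+ c) / (1 - q ^+ (s + k).+1)).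

Lemma divX_qtrinomS1 a b k : qtrinom a b k =
  qtrinom a.+1 b k * (1 - q ^+ a.+1) / (1 - q ^+ (a + b + k).+1).
Proof. by rewrite qtrinomS1 mulfK ?subr1X_neq0. Qed.

(** Remove the final D: a word of length $N = a+b+k$ remains, and the D created a descent at $N$
    unless that word itself ends in D. *)
Lemma freeD_gfS a b k : freeD_gf a b.+1 k =
  q ^+ (a + b + k) * free_gf a b k + (1 - q ^+ (a + b + k)) * freeD_gf a b k.
Proof.
rewrite /freeD_gf /free_gf.
have -> : qtri k * q ^+ (a + k) * qtrinom a b.+1 k *
   ((1 - q ^+ b.+1) / (1 - q ^+ (a + b.+1 + k))) =
   qtri k * q ^+ (a + k) * (qtrinom a b.+1 k * (1 - q ^+ b.+1)) /
   (1 - q ^+ (a + b.+1 + k)) by rewrite !mulrA.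
rewrite qtrinomS2 addnS addSn mulrA mulfK ?subr1X_neq0 //.
(* Length 0 is the only case in which the denominator $1-q^{a+b+k}$ vanishes. *)
case: (posnP (a + b + k)%N) => [|N_gt0].
  by case: a b k => [|a] [|b] [|k] // _; rewrite !expr0 !subrr; ring.
have N0 := subr1X_neq0 N_gt0.
by move: N0; rewrite !exprD => N0; field.
Qed.

Lemma badD_gfS s c k : (0 < s)%N -> badD_gf s c.+1 k =
  q ^+ (s + c + k) * bad_gf s c k + (1 - q ^+ (s + c + k)) * badD_gf s c k.
Proof.
move=> s_gt0; rewrite /badD_gf /bad_gf.
(* The identity holds with this quotient replaced by any value, so [field] may treat it as a
   variable. *)
set u := (1 - q ^+ k) / _.
have -> : qtri k * q ^+ (s + k) * qtrinom s c.+1 k *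
   ((1 - q ^+ c.+1) / (1 - q ^+ (s + c.+1 + k))) =
   qtri k * q ^+ (s + k) * (qtrinom s c.+1 k * (1 - q ^+ c.+1)) /
   (1 - q ^+ (s + c.+1 + k)) by rewrite !mulrA.
rewrite qtrinomS2 addnS addSn mulrA mulfK ?subr1X_neq0 //.
have N0 : 1 - q ^+ (s + c + k) != 0 by rewrite subr1X_neq0 ?addn_gt0 ?s_gt0.
have N1 := subr1X_neq0 (ltn0Sn (s + k)).
by move: N0 N1; rewrite !exprS !exprD => N0 N1; field; rewrite N0 N1.
Qed.

(** The three terms sort words by their last letter U, D, X. A final X creates a descent exactly
    when a final D would, so it may be traded for a D. Over the denominator $1-q^{a+b+k}$ the terms
    carry the factors $1-q^a$, $q^{a+k}(1-q^b)$ and $q^a(1-q^k)$, whose sum telescopes. *)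
Lemma free_gfE a b k : (0 < a + b + k)%N -> free_gf a b k =
  (if a is a'.+1 then free_gf a' b k else 0) + freeD_gf a b k
  + (if k is k'.+1 then freeD_gf a b.+1 k' else 0).
Proof.
move=> N_gt0; have N0 := subr1X_neq0 N_gt0.
have -> : (if a is a'.+1 then free_gf a' b k else 0) =
  free_gf a b k * (1 - q ^+ a) / (1 - q ^+ (a + b + k)).
  case: a {N_gt0} N0 => [|a] N0; first by rewrite subrr mulr0 mul0r.
  by rewrite !addSn /free_gf -[_ * _ * (1 - _)]mulrA qtrinomS1
    [in RHS]mulrA mulfK.
have -> : (if k is k'.+1 then freeD_gf a b.+1 k' else 0) =
  free_gf a b k * q ^+ a * (1 - q ^+ k) / (1 - q ^+ (a + b + k)).
  case: k {N_gt0} N0 => [|k] N0; first by rewrite subrr mulr0 mul0r.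
  rewrite /free_gf qtriS /freeD_gf.
  rewrite [RHS](_ : _ = qtri k * q ^+ k * q ^+ a
    * (qtrinom a b k.+1 * (1 - q ^+ k.+1)) / (1 - q ^+ (a + b + k.+1)));
    last by ring.
  rewrite qtrinomS3.
  rewrite [LHS](_ : _ = qtri k * q ^+ (a + k)
    * (qtrinom a b.+1 k * (1 - q ^+ b.+1)) / (1 - q ^+ (a + b.+1 + k)));
    last by ring.
  by rewrite qtrinomS2 !addnS !addSn exprD; ring.
rewrite /freeD_gf /free_gf.
by move: N0; rewrite !exprD => N0; field.
Qed.

(** The last-letter recurrence for the correction: removing a final U lowers [s] and keeps [c], and
    a final X is again traded for a D, which raises [c]. *)
Lemma bad_gfS s c k : (0 < s)%N -> bad_gf s.+1 c k =
  bad_gf s c k + badD_gf s.+1 c k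
  + (if k is k'.+1 then badD_gf s.+1 c.+1 k' else 0).
Proof.
move=> s_gt0; rewrite /bad_gf /badD_gf (divX_qtrinomS1 s).
have N0 := subr1X_neq0 (ltn0Sn (s + c + k)).
have N1 : 1 - q ^+ (s + k) != 0 by rewrite subr1X_neq0 ?addn_gt0 ?s_gt0.
have N2 := subr1X_neq0 (ltn0Sn (s + k)).
have N3 := subr1X_neq0 (ltn0Sn (s + k).+1).
have N4 := subr1X_neq0 (ltn0Sn s).
case: k N0 N1 N2 N3 => [|k] N0 N1 N2 N3.
  move: N0 N1 N2 N3; rewrite !addSn !addn0 !exprS expr0 !exprD => N0 N1 N2 N3.
  by field; rewrite ?N0 ?N1 ?N2 ?N3.
rewrite qtriS.
(* The term of the final X is brought to the trinomial [qtrinom s.+1 c k.+1] that the other terms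
   share. *)
have -> : qtri k * q ^+ (s.+1 + k) * qtrinom s.+1 c.+1 k
  * ((1 - q ^+ c.+1) / (1 - q ^+ (s.+1 + c.+1 + k))) =
  qtri k * q ^+ (s.+1 + k) * (qtrinom s.+1 c k.+1 * (1 - q ^+ k.+1))
  / (1 - q ^+ (s.+1 + c + k.+1)).
  rewrite qtrinomS3 -qtrinomS2 !addnS !addSn; ring.
move: N0 N1 N2 N3.
rewrite !(addSn, addnS) !(exprS, exprD) => N0 N1 N2 N3.
by field; rewrite ?N0 ?N1 ?N2 ?N3.
Qed.

(** On the line [b = r + a] one has [s = b] and [c = a]. A ballot word there can end neither in U
    nor in X, so the closed form for all words must agree with that for words ending in D. *)
Lemma gf_boundary a b k : (0 < b)%N ->
  free_gf a b k - bad_gf b a k = freeD_gf a b k - badD_gf b a k.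
Proof.
move=> b_gt0; rewrite /bad_gf /badD_gf /free_gf /freeD_gf (qtrinomC b a).
have N0 : 1 - q ^+ (a + b + k) != 0.
  by rewrite subr1X_neq0 // -addnA addnCA addn_gt0 b_gt0.
have N1 : 1 - q ^+ (b + k) != 0 by rewrite subr1X_neq0 ?addn_gt0 ?b_gt0.
have N2 := subr1X_neq0 (ltn0Sn (b + k)).
rewrite [(b + a)%N]addnC.
move: N0 N1 N2; rewrite !exprS !exprD => N0 N1 N2.
by field; rewrite ?N0 ?N1 ?N2.
Qed.

(** With fewer than [r] letters D no word can violate the ballot condition, so the correction starts
    at [b = r]; this also keeps [b - r] a true subtraction. *)
Definition ballot_gf (r a b k : nat) : F :=
  free_gf a b k - (if (r <= b)%N then bad_gf (a + r) (b - r) k else 0).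

Definition ballotD_gf (r a b k : nat) : F :=
  freeD_gf a b k - (if (r <= b)%N then badD_gf (a + r) (b - r) k else 0).

Lemma badD_gf0 s k : badD_gf s 0 k = 0.
Proof. by rewrite /badD_gf expr0 subrr mul0r mulr0 mul0r. Qed.

Lemma freeD_gf0 a k : freeD_gf a 0 k = 0.
Proof. by rewrite /freeD_gf expr0 subrr mul0r mulr0. Qed.

Lemma ballotD_gf0 r a k : (0 < r)%N -> ballotD_gf r a 0 k = 0.
Proof. by case: r => // r _; rewrite /ballotD_gf freeD_gf0 subrr. Qed.

Lemma ballotD_gfS r a b k : (0 < r)%N -> ballotD_gf r a b.+1 k =
  q ^+ (a + b + k) * ballot_gf r a b k
  + (1 - q ^+ (a + b + k)) * ballotD_gf r a b k.
Proof.
move=> r_gt0; rewrite /ballotD_gf /ballot_gf freeD_gfS.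
case: (ltngtP r b.+1) => [lerb|ltbr|eqr].
- move: lerb; rewrite ltnS => lerb; rewrite lerb subSn //.
  rewrite badD_gfS ?addn_gt0 ?r_gt0 ?orbT // -(addnA a r) subnKC //.
  by ring.
- by rewrite leqNgt (ltn_trans (ltnSn b) ltbr) /=; ring.
(* Here the correction has just started, at excess 0, where [badD_gf] vanishes. *)
- by rewrite eqr ltnn subnn badD_gf0; ring.
Qed.

Lemma ballot_gfE r a b k : (0 < r)%N -> (b < r + a)%N -> (0 < a + b + k)%N ->
  ballot_gf r a b k =
  (if a is a'.+1 then ballot_gf r a' b k else 0) + ballotD_gf r a b k
  + (if k is k'.+1 then ballotD_gf r a b.+1 k' else 0).
Proof.
move=> r_gt0 ltb N_gt0; rewrite /ballotD_gf /ballot_gf free_gfE //.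
case: (leqP r b) => [lerb|ltbr]; last first.
  case: k N_gt0 => [|k] _; first by case: a {ltb} => [|a]; ring.
  case: (ltngtP r b.+1) ltbr => [//|_ _|-> _].
  - by case: a {ltb} => [|a]; ring.
  by rewrite subnn badD_gf0; case: a {ltb} => [|a]; ring.
(* From [r <= b < r + a] there is at least one U, so [bad_gfS] applies. *)
case: a ltb {N_gt0} => [|a] ltb; first by rewrite addn0 ltnNge lerb in ltb.
rewrite addSn bad_gfS ?addn_gt0 ?r_gt0 ?orbT //.
case: k => [|k]; first by ring.
by rewrite leqW // subSn //; ring.
Qed.

Lemma ballot_gf_boundary r a b k : (0 < r)%N -> b = (r + a)%N ->
  ballot_gf r a b k = ballotD_gf r a b k.
Proof.
move=> r_gt0 ->; rewrite /ballot_gf /ballotD_gf leq_addr addKn addnC.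
by apply: gf_boundary; rewrite addn_gt0 r_gt0 orbT.
Qed.

End QIdentities.

(** * Ballot words *)

Definition letter : Type := option bool.
HB.instance Definition _ := Finite.on letter.

Definition U : letter := Some true.
Definition D : letter := Some false.
Definition X : letter := None.

Definition in_top (l : letter) : bool := l != D.
Definition in_bot (l : letter) : bool := l != U.

(* Words are stored in reverse: the head of the list is the letter of the
   largest entry, and the letter of entry v has v - 1 letters after it. *)
Fixpoint lattice (r : nat) (w : seq letter) : bool :=
  if w is l :: w' then
    lattice r w' && (in_bot l ==> (count_mem D w' < r + count_mem U w'))%N
  else true.

(** With two rows, [i] is a descent iff [i] occurs in the top row and [i + 1] in the bottom one.
    Here [i] is [size w'], the entry of the letter just before [l]. *)
Fixpoint wmaj (w : seq letter) : nat :=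
  if w is l :: w' then
    (wmaj w' + (if in_bot l && (if w' is l' :: _ then in_top l' else false)
                then size w' else 0))%N
  else 0%N.

Definition ballot (r a b k : nat) (w : seq letter) : bool :=
  [&& lattice r w, count_mem U w == a, count_mem D w == b
    & count_mem X w == k].

Lemma lattice_leq r w : lattice r w -> (count_mem D w <= r + count_mem U w)%N.
Proof.
elim: w => //= -[[]|] w IHw /andP[/IHw le_w] //=; rewrite !add0n //.
by rewrite addnS ltnW // ltnS.
Qed.

Lemma sum_tupleS (V : nmodType) (T : finType) N (p : pred (seq T))
    (f : seq T -> V) :
  \sum_(w : N.+1.-tuple T | p w) f w =
  \sum_x \sum_(w : N.-tuple T | p (x :: w)) f (x :: w).
Proof.
rewrite pair_big_dep /=.
rewrite (reindex (fun xw : T * N.-tuple T => cons_tuple xw.1 xw.2)) //=.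
exists (fun w => (thead w, [tuple of behead w])) => [[x w] _|w _] /=.
  by rewrite theadE; congr pair; apply: val_inj.
by rewrite [RHS]tuple_eta; apply: val_inj.
Qed.

Lemma sum_letter (V : nmodType) (f : letter -> V) :
  \sum_l f l = f U + f D + f X.
Proof.
rewrite (bigD1 U) //= (bigD1 D) //= (bigD1 X) //= big1.
  by rewrite addr0 addrA.
by case=> [[]|].
Qed.

(** * Recurrences and closed forms of the sums over ballot words *)

Section BallotSum.
Variables (F : fieldType) (q : F) (r : nat).
Hypotheses (q_generic : forall i, (0 < i)%N -> q ^+ i != 1) (r_gt0 : (0 < r)%N).

Definition ballot_sum N a b k : F :=
  \sum_(w : N.-tuple letter | ballot r a b k w) q ^+ wmaj w.

Definition ballotD_sum N a b k : F :=
  \sum_(w : N.-tuple letter | ballot r a b k w && (ohead w == Some D))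
     q ^+ wmaj w.

(** An appended D or X makes [N] a descent unless the preceding letter is D; splitting the words by
    that letter gives both coefficients. *)
Lemma sum_wmaj_bot N a b k l : in_bot l ->
  \sum_(w : N.-tuple letter | ballot r a b k w) q ^+ wmaj (l :: w) =
  q ^+ N * ballot_sum N a b k + (1 - q ^+ N) * ballotD_sum N a b k.
Proof.
move=> l_bot; rewrite /ballot_sum /ballotD_sum.
rewrite (bigID (fun w : N.-tuple letter => ohead w == Some D)) /=.
rewrite [in RHS](bigID (fun w : N.-tuple letter => ohead w == Some D)) /=.
rewrite l_bot /=.
set A := (X in _ = q ^+ N * (X + _) + _).
set B := (X in _ = q ^+ N * (_ + X) + _).
set A' := (X in X + _ = _); set B' := (X in _ + X = _).
have -> : A' = A.
  apply: eq_bigr => w /andP[_]; case: w => [[|x w] /= _] //.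
  by move=> /eqP[->]; rewrite addn0.
have -> : B' = q ^+ N * B.
  rewrite /B big_distrr /=; apply: eq_bigr => w /andP[_].
  (* The empty word has no preceding letter, but then [N = 0] and $q^N = 1$. *)
  rewrite -exprD; case: w => [[|x w] /= /eqP sz_w].
    by rewrite -sz_w addn0.
  rewrite /in_top sz_w /=; case: (x =P D) => [->|_ _] //=.
  by rewrite addnC.
by rewrite -/A; ring.
Qed.

(** The last letter is U, D or X. A final X leaves the numbers of U's and D's as they are, so it is
    allowed only strictly below the line [b = r + a]. *)
Lemma ballot_sumS N a b k : (b <= r + a)%N -> ballot_sum N.+1 a b k =
  (if a is a'.+1 then ballot_sum N a' b k else 0)
  + ballotD_sum N.+1 a b k
  + (if k is k'.+1 then
       if (b < r + a)%N then
         q ^+ N * ballot_sum N a b k' + (1 - q ^+ N) * ballotD_sum N a b k'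
       else 0
     else 0).
Proof.
move=> leb.
rewrite [LHS](sum_tupleS _ (ballot r a b k) (fun w => q ^+ wmaj w)) sum_letter.
rewrite [ballotD_sum N.+1 _ _ _](sum_tupleS _
  (fun w => ballot r a b k w && (ohead w == Some D)) (fun w => q ^+ wmaj w)).
rewrite sum_letter /=.
rewrite [X in _ = _ + (X + _ + _) + _]big_pred0;
  last by move=> w; rewrite andbF.
rewrite [X in _ = _ + (_ + _ + X) + _]big_pred0;
  last by move=> w; rewrite andbF.
rewrite add0r addr0; congr (_ + _ + _).
- case: a leb => [|a] leb.
    by rewrite big_pred0 // => w; rewrite /ballot /= !andbF.
  apply: eq_big => [w|w _]; last by rewrite addn0.
  by rewrite /ballot /= andbT !add0n add1n eqSS.
- by apply: eq_bigl => w; rewrite eqxx andbT.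
case: k => [|k].
  by rewrite big_pred0 // => w; rewrite /ballot /= !andbF.
case: ifP => [ltb|geb].
  rewrite -(sum_wmaj_bot _ _ _ _ (l := X)) //.
  apply: eq_bigl => w; rewrite /ballot /= !add0n add1n eqSS.
  case: eqP => [->|]; last by rewrite !andbF.
  case: eqP => [->|]; last by rewrite !andbF.
  by rewrite ltb andbT.
rewrite big_pred0 // => w; rewrite /ballot /= !add0n.
case: eqP => [->|]; last by rewrite !andbF.
case: eqP => [->|]; last by rewrite !andbF.
by rewrite geb !andbF.
Qed.

(** Since [b'.+1 <= r + a], the final D satisfies the ballot condition automatically. *)
Lemma ballotD_sumS N a b k : (b <= r + a)%N -> ballotD_sum N.+1 a b k =
  if b is b'.+1 then
     q ^+ N * ballot_sum N a b' k + (1 - q ^+ N) * ballotD_sum N a b' k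
  else 0.
Proof.
move=> leb.
rewrite /ballotD_sum (sum_tupleS _
  (fun w => ballot r a b k w && (ohead w == Some D)) (fun w => q ^+ wmaj w)).
rewrite sum_letter /=.
rewrite [X in X + _ + _ = _]big_pred0; last by move=> w; rewrite andbF.
rewrite [X in _ + _ + X = _]big_pred0; last by move=> w; rewrite andbF.
rewrite add0r addr0.
case: b leb => [|b] leb.
  by rewrite big_pred0 // => w; rewrite /ballot /= !andbF.
rewrite -(sum_wmaj_bot _ _ _ _ (l := D)) //.
apply: eq_bigl => w; rewrite /ballot /= !add0n add1n eqSS eqxx andbT.
case: eqP => [->|]; last by rewrite !andbF.
case: eqP => [->|]; last by rewrite !andbF.
by rewrite leb andbT.
Qed.

(** Both equalities are proved in one induction on the length, as each recurrence involves both
    sums. *)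
Lemma ballot_sumE N a b k : (a + b + k)%N = N -> (b <= r + a)%N ->
  ballot_sum N a b k = ballot_gf q r a b k
  /\ ballotD_sum N a b k = ballotD_gf q r a b k.
Proof.
elim: N a b k => [|N IHN] a b k eqN leb.
  case: a b k eqN {leb} => [|a] [|b] [|k] // _; split; last first.
    rewrite ballotD_gf0 // /ballotD_sum big_pred0 // => w.
    by rewrite tuple0 andbF.
  rewrite /ballot_sum (big_pred1 [tuple]) /= => [|w]; last first.
    by rewrite (tuple0 w); apply/esym; apply: eqxx.
  rewrite /ballot_gf leqNgt r_gt0 subr0 /free_gf /qtri /qtrinom /qpoch.
  by rewrite bin0n expr0 !big_ord0 !mulr1 mul1r divr1.
(* This comes first because the recurrence for [ballot_sum] uses [ballotD_sum] at the same
   length. *)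
have eqD : ballotD_sum N.+1 a b k = ballotD_gf q r a b k.
  rewrite ballotD_sumS //; case: b eqN leb => [|b] eqN leb.
    by rewrite ballotD_gf0.
  have eqN' : (a + b + k)%N = N by move: eqN; rewrite addnS addSn => -[].
  have [-> ->] := IHN a b k eqN' (ltnW leb).
  by rewrite ballotD_gfS // eqN'.
split=> //; rewrite ballot_sumS // eqD.
(* On the line [b = r + a] the term of the final X is absent, and removing a final U would leave too
   many D's, so only words ending in D remain. *)
case: (ltngtP b (r + a)%N) leb => [ltb _|//|eqb _]; last first.
  rewrite (_ : (if k is _.+1 then 0 else 0) = 0); last by case: (k).
  rewrite addr0 ballot_gf_boundary //.
  case: a eqN eqb {eqD} => [|a] eqN eqb; first by rewrite add0r.
  rewrite /ballot_sum big_pred0 ?add0r // => w.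
  apply/negP=> /and4P[/lattice_leq le_w /eqP eq_a /eqP eq_b _].
  by move: le_w; rewrite eq_a eq_b eqb addnS ltnn.
rewrite ballot_gfE ?eqN //; congr (_ + _ + _).
  case: a eqN ltb {eqD} => [|a] // eqN ltb.
  have eqN' : (a + b + k)%N = N by move: eqN; rewrite !addSn => -[].
  by have [] := IHN a b k eqN' ltac:(by rewrite addnS in ltb).
case: k eqN {eqD} => [|k] // eqN.
have eqN' : (a + b + k)%N = N by move: eqN; rewrite !addnS => -[].
(* In [ballot_gfE] the final X appears as a final D with [b.+1] letters D; [ballotD_gfS] unfolds it
   to the form found in [ballot_sumS]. *)
have [-> ->] := IHN a b k eqN' (ltnW ltb).
by rewrite ballotD_gfS // eqN'.
Qed.

End BallotSum.

(** * Entries of the rows *)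


Section Places.
Local Open Scope nat_scope.

(** For [in_top] and [in_bot] this is a row of the tableau read from left to right; [rcons] is used
    because the head of the word carries the largest entry. *)
Fixpoint places (p : pred letter) (w : seq letter) : seq nat :=
  if w is l :: w' then
    if p l then rcons (places p w') (size w) else places p w'
  else [::].

Lemma size_places p w : size (places p w) = count p w.
Proof. by elim: w => //= l w IHw; case: ifP; rewrite ?size_rcons IHw. Qed.

Lemma places_gt0 p w v : v \in places p w -> 0 < v <= size w.
Proof.
elim: w => //= l w IHw; case: ifP => _; rewrite ?mem_rcons ?inE.
  by case/predU1P => [->|/IHw /andP[-> /leqW]] //=; rewrite ltnSn.
by case/IHw/andP=> -> /leqW.
Qed.

Lemma mem_places p w v : 0 < v <= size w ->
  (v \in places p w) = p (nth U w (size w - v)).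
Proof.
elim: w => [|l w IHw] /=; first by case: v.
case/andP=> v_gt0; rewrite leq_eqVlt => /predU1P[-> | ltv].
  rewrite subnn /=; case: ifP => [_|pl]; first by rewrite mem_rcons mem_head.
  by apply/negP=> /places_gt0; rewrite ltnn andbF.
rewrite subSn //= -IHw ?v_gt0 //; case: ifP => // _.
by rewrite mem_rcons inE ltn_eqF.
Qed.

Lemma places_sorted p w : sorted ltn (places p w).
Proof.
elim: w => //= l w IHw; case: ifP => // _.
rewrite -[rcons _ _]revK rev_rcons rev_sorted /= path_min_sorted; last first.
  by apply/allP=> v; rewrite mem_rev => /places_gt0/andP[].
by rewrite -rev_sorted revK.
Qed.

Lemma size_places_cons (p : pred letter) l w :
  size (places p (l :: w)) = p l + size (places p w).
Proof. by rewrite !size_places. Qed.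

Lemma nth_places_cons (p : pred letter) l w i : i < size (places p w) ->
  nth 0 (places p (l :: w)) i = nth 0 (places p w) i.
Proof. by move=> lti /=; case: ifP => // _; rewrite nth_rcons lti. Qed.

Lemma nth_places_last (p : pred letter) l w : p l ->
  nth 0 (places p (l :: w)) (size (places p w)) = (size w).+1.
Proof. by move=> /= ->; rewrite nth_rcons ltnn eqxx. Qed.

Lemma nth_places_le p w i : nth 0 (places p w) i <= size w.
Proof.
case: (ltnP i (size (places p w))) => [lti|gei]; last by rewrite nth_default.
by have /andP[] := places_gt0 (mem_nth 0 lti).
Qed.

Lemma mem_places_cons (p : pred letter) l w v : v \in places p (l :: w) =
  (v == (size w).+1) && p l || (v \in places p w).
Proof.
by rewrite /=; case: ifP => _; rewrite ?mem_rcons ?inE ?andbT ?andbF.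
Qed.

Lemma count_top w : count in_top w = count_mem U w + count_mem X w.
Proof. by elim: w => //= -[[]|] w ->; rewrite ?addSn ?addnS. Qed.

Lemma count_bot w : count in_bot w = count_mem D w + count_mem X w.
Proof. by elim: w => //= -[[]|] w ->; rewrite ?addSn ?addnS. Qed.

Lemma size_letters w : size w = count_mem U w + count_mem D w + count_mem X w.
Proof. by elim: w => //= -[[]|] w ->; rewrite ?addSn ?addnS. Qed.

(** The ballot condition is strictness down columns. The bottom box in column [j >= r] lies under
    the box of index [j - r] in the top row, which must exist and carry a smaller entry. *)
Lemma latticeP r w : reflect
  (forall j, r <= j < size (places in_bot w) ->
     (j - r < size (places in_top w)) /\
     (nth 0 (places in_top w) (j - r) < nth 0 (places in_bot w) j))
  (lattice r w).
Proof.
apply: (iffP idP) => [|H].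
  elim: w => [_ j|l w IHw]; first by rewrite ltn0 andbF.
  case/andP=> /IHw {}IHw step j; rewrite !size_places_cons.
  case: (ltnP j (size (places in_bot w))) => [ltj /andP[ler _]|gej].
    have [|lt_top lt_nth] := IHw j; first by rewrite ler.
    by rewrite !nth_places_cons // (leq_trans lt_top) ?leq_addl.
  (* The only new bottom box is the one [l] fills, and its entry exceeds all earlier ones; what
     remains is that the box above it is already filled. *)
  case: (boolP (in_bot l)) step => [l_bot /= step|_ _]; last first.
    by rewrite ltnNge gej andbF.
  rewrite add1n ltnS => /andP[ler lej].
  have -> : j = size (places in_bot w) by apply/eqP; rewrite eqn_leq lej.
  (* The letters X count in both rows and cancel, so the bound on D's against U's compares the row
     lengths. *)
  have lt_top : size (places in_bot w) - r < size (places in_top w).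
    have : size (places in_bot w) < r + size (places in_top w).
      by rewrite !size_places count_top count_bot addnA ltn_add2r.
    by move: gej ler lej; lia.
  rewrite (leq_trans lt_top) ?leq_addl // nth_places_cons // nth_places_last //.
  by rewrite ltnS nth_places_le.
elim: w H => //= l w IHw H; apply/andP; split.
  apply: IHw => j /andP[ler ltj].
  have [|lt_top lt_nth] := H j.
    by rewrite ler (leq_trans ltj) // (size_places_cons in_bot) leq_addl.
  have {lt_top} : j - r < in_top l + size (places in_top w).
    by rewrite -size_places_cons.
  (* If the top box were filled by [l], its entry [(size w).+1] would be too large to lie above an
     entry of [w]. *)
  case: (ltnP (j - r) (size (places in_top w))) => [lt_top _|ge_top lt_top].
    split=> //; move: lt_nth.
    by rewrite (nth_places_cons (p := in_top)) ?(nth_places_cons (p := in_bot)).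
  have l_top : in_top l.
    by case: (in_top l) lt_top => //; rewrite add0n ltnNge ge_top.
  have eqj : j - r = size (places in_top w).
    by move: lt_top ge_top; rewrite l_top; lia.
  move: lt_nth; rewrite eqj (nth_places_last (p := in_top)) //.
  rewrite (nth_places_cons (p := in_bot)) //.
  move=> /leq_trans/(_ (nth_places_le _ _ _)).
  by rewrite ltnNge leqnSn.
apply/implyP=> l_bot.
(* In the first [r] columns nothing lies above the new bottom box, and the bound holds because [w]
   has fewer than [r] letters D. *)
case: (ltnP (size (places in_bot w)) r) => [ltr|ler].
  rewrite size_places count_bot in ltr.
  exact: leq_ltn_trans (leq_addr _ _) (leq_trans ltr (leq_addr _ _)).
have [|lt_top lt_nth] := H (size (places in_bot w)).
  by rewrite ler (size_places_cons in_bot) l_bot ltnSn.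
move: lt_nth; rewrite (nth_places_last (p := in_bot)) // => lt_nth.
(* If the box above is not filled yet, [l] must fill it too, and both boxes of the column would get
   the same entry. *)
case: (ltnP (size (places in_bot w) - r) (size (places in_top w)))
    => [lt|ge_top].
  move: lt; rewrite ltn_subLR // !size_places count_top count_bot addnA.
  by rewrite ltn_add2r.
have {lt_top} lt_top :
    size (places in_bot w) - r < in_top l + size (places in_top w).
  by rewrite -size_places_cons.
have l_top : in_top l.
  by case: (in_top l) lt_top => //; rewrite add0n ltnNge ge_top.
have eqs : size (places in_bot w) - r = size (places in_top w).
  by move: lt_top ge_top; rewrite l_top; lia.
by move: lt_nth; rewrite eqs (nth_places_last (p := in_top)) // ltnn.
Qed.

(** This is the shape of [maj] for a tableau whose rows are the two lists of places; the range
    matches that of [maj], and its last index contributes nothing. *)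
Lemma wmajE w : wmaj w =
  \sum_(0 <= i < (size w).+1
         | (i \in places in_top w) && (i.+1 \in places in_bot w)) i.
Proof.
have gt_size p s v : size s < v -> (v \in places p s) = false.
  by move=> lt_v; apply/negP=> /places_gt0 /andP[_]; rewrite leqNgt lt_v.
elim: w => [|l w IHw]; first by rewrite big_mkcond big_nat1.
(* Adding [l] can create a descent only at [size w]. *)
have -> : wmaj (l :: w) = wmaj w +
    (if (size w \in places in_top w) && in_bot l then size w else 0).
  rewrite andbC /=; case: w {IHw} => [|x w]; first by rewrite /= !if_same.
  by rewrite [_ \in _]mem_places_cons eqxx gt_size //= orbF.
rewrite IHw big_mkcond big_nat_recr //= (gt_size in_bot) // andbF addn0.
rewrite [RHS]big_mkcond [RHS]big_nat_recr // [in RHS]big_nat_recr //=.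
rewrite [X in _ = _ + X]ifF ?addn0; last first.
  by rewrite [X in _ && X](gt_size in_bot (l :: w)) ?andbF.
rewrite ![_ \in (if _ then _ else _)]mem_places_cons.
congr (_ + _); last first.
  by rewrite eqxx (gt_size in_bot) // orbF (ltn_eqF (ltnSn _)).
apply: eq_big_nat => i /andP[_ lti].
by rewrite !mem_places_cons (ltn_eqF (leqW lti)) (ltn_eqF (n := (size w).+1)).
Qed.

End Places.

(** * Increasing tableaux with two rows and their words *)

Section TwoRows.
Local Open Scope nat_scope.
Variables (n m r k : nat).
Hypotheses (le_mn : m <= n) (le_rn : r <= n).

Notation la := [:: n; m].
Notation mu := [:: r].
Notation Box := (box la mu).
Notation off i := (nth 0 mu i).
Notation len i := (nth 0 la i).

Lemma box_inj (b c : Box) : row b = row c -> col b = col c -> b = c.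
Proof.
case: b c => -[i j] ? [[i' j'] ?] /= eq_row eq_col; apply: val_inj => /=.
by congr pair; apply: val_inj.
Qed.

Lemma box_col (b : Box) : off (row b) <= col b < len (row b).
Proof. exact: (valP b). Qed.

Lemma row_lt2 (b : Box) : row b < 2.
Proof. exact: ltn_ord. Qed.

Lemma ex_box i j : i < 2 -> off i <= j < len i ->
  exists b : Box, row b = i /\ col b = j.
Proof.
move=> lti ltj; have ltjn : j < n.
  by case/andP: ltj => _ /leq_trans; apply; case: i lti => [|[]].
by exists (exist _ (Ordinal lti, Ordinal ltjn) ltj : Box).
Qed.

Lemma card_box : #|{: Box}| = n - r + m.
Proof.
have interval s e : e <= n -> \sum_(j < n | s <= j < e) 1 = e - s.
  move=> len; rewrite -(big_mkord (fun j => s <= j < e) (fun=> 1)).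
  rewrite -[RHS]muln1 -sum_nat_const_nat (big_nat_widen s e n) //.
  rewrite (big_nat_widenl s 0) //; apply: eq_bigl => j.
  by rewrite andbC.
rewrite card_sig -sum1_card.
rewrite -(pair_big_dep xpredT (fun (i : 'I_2) (j : 'I_n) => off i <= j < len i)
            (fun _ _ => 1)) /=.
by rewrite !big_ord_recl big_ord0 /= addn0 interval // (interval 0 m) // subn0.
Qed.

Definition occurs (T : filling la mu) i v : bool :=
  [exists b : Box, (row b == i) && (entry T b == v)].

Lemma occursP T i v :
  reflect (exists2 b : Box, row b = i & entry T b = v) (occurs T i v).
Proof.
apply: (iffP existsP) => [[b /andP[/eqP ? /eqP ?]]|[b <- <-]]; exists b => //.
by rewrite !eqxx.
Qed.

Definition in_row i : pred letter := if i == 0 then in_top else in_bot.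

(** A value that occurs in neither row would also get U; [Inc_occurs] excludes this for the values
    from 1 to the maximal entry. *)
Definition letter_of (T : filling la mu) v : letter :=
  if occurs T 1 v then if occurs T 0 v then X else D else U.

Definition word_of N (T : filling la mu) : N.-tuple letter :=
  [tuple letter_of T (N - i) | i < N].

Lemma nth_word_of N T i : i < N -> nth U (word_of N T) i = letter_of T (N - i).
Proof.
move=> lti; have -> : i = Ordinal lti by [].
by rewrite -tnth_nth tnth_mktuple.
Qed.

(* [inord] is harmless: no entry exceeds the number of boxes. *)
Definition tableau_of (w : seq letter) : filling la mu :=
  [ffun b : Box =>
     inord (nth 0 (places (in_row (row b)) w) (col b - off (row b)))].

(** Entries by plain coordinates, with value 0 off the shape, so that rows can be handled as lists
    of numbers. *)
Definition entry_at (T : filling la mu) i j : nat :=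
  if [pick b : Box | (row b == i) && (col b == j)] is Some b then entry T b
  else 0.

Lemma entry_atE T (b : Box) : entry_at T (row b) (col b) = entry T b.
Proof.
rewrite /entry_at; case: pickP => [c /andP[/eqP rc /eqP cc]|/(_ b)].
  by rewrite (box_inj rc cc).
by rewrite !eqxx.
Qed.

Definition row_entries (T : filling la mu) i : seq nat :=
  [seq entry_at T i (off i + j) | j <- iota 0 (len i - off i)].

Lemma mem_row_entries T i v : i < 2 -> (v \in row_entries T i) = occurs T i v.
Proof.
move=> lti; apply/mapP/occursP => [[j]|[b rb <-]].
  rewrite mem_iota add0n /= => ltj ->.
  have [|b [rb cb]] := @ex_box i (off i + j) lti.
    by rewrite leq_addr -ltn_subRL.
  by exists b; rewrite // -entry_atE rb cb.
have := box_col b; rewrite rb => /andP[le_off lt_len].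
exists (col b - off i); last by rewrite subnKC // -rb entry_atE.
by rewrite mem_iota add0n leq0n /= ltn_sub2r // (leq_ltn_trans le_off).
Qed.

Lemma nth_row_entries T (b : Box) :
  nth 0 (row_entries T (row b)) (col b - off (row b)) = entry T b.
Proof.
have /andP[le_off lt_len] := box_col b.
have ltj : col b - off (row b) < len (row b) - off (row b).
  by rewrite ltn_sub2r // (leq_ltn_trans le_off).
rewrite (nth_map 0) ?size_iota // nth_iota // add0n subnKC //.
exact: entry_atE.
Qed.

Section FromTableau.
Variable T : filling la mu.
Hypothesis incT : T \in Inc la mu k.
Let N := n - r + m - k.

Lemma Inc_max_entry : max_entry T + k = n - r + m.
Proof. by move: incT; rewrite inE card_box => /andP[_ /eqP]. Qed.

Lemma Inc_entry_range b : 0 < entry T b <= N.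
Proof.
have -> : N = max_entry T by rewrite /N -Inc_max_entry addnK.
move: incT; rewrite inE => /andP[/and4P[/forallP -> _ _ _] _] /=.
exact: leq_bigmax.
Qed.

Lemma Inc_row_lt b c : row b = row c -> col b < col c -> entry T b < entry T c.
Proof.
move: incT; rewrite inE.
case/andP=> /and4P[_ /forallP/(_ b)/forallP/(_ c) + _ _] _.
by move=> /implyP lt_row eq_row lt_col; apply: lt_row; rewrite eq_row eqxx.
Qed.

Lemma Inc_col_lt b c : col b = col c -> row b < row c -> entry T b < entry T c.
Proof.
move: incT; rewrite inE.
case/andP=> /and4P[_ _ /forallP/(_ b)/forallP/(_ c) + _] _.
by move=> /implyP lt_col eq_col lt_row; apply: lt_col; rewrite eq_col eqxx.
Qed.

Lemma Inc_occurs v : 0 < v <= N -> occurs T 0 v || occurs T 1 v.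
Proof.
have -> : N = max_entry T by rewrite /N -Inc_max_entry addnK.
case/andP=> v_gt0; rewrite -ltnS => ltv; move: incT; rewrite inE.
case/andP=> /and4P[_ _ _ /forallP/(_ (Ordinal ltv))] /=; rewrite v_gt0 /=.
case/existsP=> b /eqP eq_v _; apply/orP.
have := row_lt2 b; case eq_row: (row b) => [|[|]] // _.
  by left; apply/occursP; exists b.
by right; apply/occursP; exists b.
Qed.

Lemma in_row_letter_of i v : i < 2 -> 0 < v <= N ->
  in_row i (letter_of T v) = occurs T i v.
Proof.
move=> lti /Inc_occurs; rewrite /letter_of.
by case: i lti => [|[|]] // _; case: (occurs T 0 v); case: (occurs T 1 v).
Qed.

Lemma row_entries_sorted i : i < 2 -> sorted ltn (row_entries T i).
Proof.
move=> lti; rewrite sorted_map.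
apply: (sub_in_sorted (P := [pred j | j < len i - off i]) (e := ltn)).
- move=> x y /= ltx lty lt_xy.
  have [|b [rb cb]] := @ex_box i (off i + x) lti.
    by rewrite leq_addr -ltn_subRL.
  have [|c [rc cc]] := @ex_box i (off i + y) lti.
    by rewrite leq_addr -ltn_subRL.
  have := @Inc_row_lt b c; rewrite -!entry_atE rb rc cb cc ltn_add2l.
  exact.
- by apply/allP=> j; rewrite mem_iota.
exact: iota_ltn_sorted.
Qed.

(** Both lists are strictly increasing, so it suffices that they have the same members. Thus the
    word determines the rows of the tableau. *)
Lemma places_word_of i : i < 2 ->
  places (in_row i) (word_of N T) = row_entries T i.
Proof.
move=> lti; apply: (irr_sorted_eq ltn_trans ltnn).
- exact: places_sorted.
- exact: row_entries_sorted.
move=> v; rewrite mem_row_entries //.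
case: (boolP (0 < v <= N)) => [lev|nlev].
  rewrite mem_places ?size_tuple // nth_word_of; last by lia.
  by rewrite subKn ?in_row_letter_of //; case/andP: lev.
have /negbTE -> : v \notin places (in_row i) (word_of N T).
  by apply: contra nlev => /places_gt0; rewrite size_tuple.
by apply/esym/occursP=> -[b _ eq_v]; rewrite -eq_v Inc_entry_range in nlev.
Qed.

Lemma word_ofK : tableau_of (word_of N T) = T.
Proof.
apply/ffunP=> b; rewrite ffunE places_word_of ?row_lt2 // nth_row_entries.
exact: inord_val.
Qed.

Lemma size_row_entries i : size (row_entries T i) = len i - off i.
Proof. by rewrite size_map size_iota. Qed.

Lemma lattice_word_of : lattice r (word_of N T).
Proof.
apply/latticeP.
rewrite (@places_word_of 0) // (@places_word_of 1) // !size_row_entries /=.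
rewrite subn0 => j /andP[lerj ltjm].
have ltjn := leq_trans ltjm le_mn.
have [|b [rb cb]] := @ex_box 0 j isT; first by rewrite /= lerj.
have [|c [rc cc]] := @ex_box 1 j isT; first by rewrite /= ltjm.
split; first by rewrite ltn_sub2r // (leq_ltn_trans lerj).
have := nth_row_entries T b; rewrite rb cb /= => ->.
have := nth_row_entries T c; rewrite rc cc /= subn0 => ->.
by apply: Inc_col_lt; rewrite ?rb ?rc ?cb ?cc.
Qed.

Lemma count_word_of :
  count in_top (word_of N T) = n - r /\ count in_bot (word_of N T) = m.
Proof.
rewrite -!size_places (@places_word_of 0) // (@places_word_of 1) //.
by rewrite !size_row_entries /= subn0.
Qed.

End FromTableau.

Section FromWord.
Variable w : seq letter.
Hypotheses (lat_w : lattice r w) (top_w : count in_top w = n - r)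
  (bot_w : count in_bot w = m) (size_w : size w + k = n - r + m).

Let T := tableau_of w.

Lemma size_places_row i : i < 2 -> size (places (in_row i) w) = len i - off i.
Proof. by case: i => [|[|]] // _; rewrite size_places /= ?subn0. Qed.

Lemma col_lt_size (b : Box) :
  col b - off (row b) < size (places (in_row (row b)) w).
Proof.
rewrite size_places_row ?row_lt2 //; have /andP[le_off lt_len] := box_col b.
by rewrite ltn_sub2r // (leq_ltn_trans le_off).
Qed.

Lemma entry_tableau_of b :
  entry T b = nth 0 (places (in_row (row b)) w) (col b - off (row b)).
Proof.
rewrite /entry /T /tableau_of ffunE inordK // ltnS card_box -size_w.
have /andP[_ le_w] := places_gt0 (mem_nth 0 (col_lt_size b)).
exact: leq_trans le_w (leq_addr _ _).
Qed.

Lemma occurs_tableau_of i v : i < 2 ->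
  occurs T i v = (v \in places (in_row i) w).
Proof.
move=> lti; apply/occursP/idP => [[b <- <-]|v_in].
  by rewrite entry_tableau_of mem_nth ?col_lt_size.
have := v_in; rewrite -index_mem size_places_row // => lt_idx.
have [|b [rb cb]] := @ex_box i (off i + index v (places (in_row i) w)) lti.
  by rewrite leq_addr -ltn_subRL.
by exists b => //; rewrite entry_tableau_of rb cb addKn nth_index.
Qed.

Lemma entry_tableau_of_range b : 0 < entry T b <= size w.
Proof.
by rewrite entry_tableau_of; apply: places_gt0 (mem_nth 0 (col_lt_size b)).
Qed.

Lemma word_has_entry v : 0 < v <= size w -> exists b, entry T b = v.
Proof.
move=> lev; have : occurs T 0 v || occurs T 1 v.
  by rewrite !occurs_tableau_of // !mem_places //; case: nth => [[]|].
by case/orP=> /occursP[b _ <-]; exists b.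
Qed.

Lemma max_entry_tableau_of : max_entry T = size w.
Proof.
apply/eqP; rewrite eqn_leq; apply/andP; split.
  by apply/bigmax_leqP => b _; case/andP: (entry_tableau_of_range b).
case: (posnP (size w)) => [->//|w_gt0].
have [|b <-] := @word_has_entry (size w); first by rewrite w_gt0 leqnn.
exact: leq_bigmax.
Qed.

(** Rows increase because places are sorted, columns by [latticeP], and every value up to [size w]
    occurs because each letter belongs to some row. *)
Lemma tableau_of_Inc : T \in Inc la mu k.
Proof.
rewrite inE max_entry_tableau_of size_w card_box eqxx andbT.
apply/and4P; split.
- by apply/forallP=> b; case/andP: (entry_tableau_of_range b).
- apply/forallP=> b; apply/forallP=> c; apply/implyP=> /andP[/eqP rbc lt_col].
  rewrite !entry_tableau_of rbc.
  apply: (sorted_ltn_nth ltn_trans 0 (places_sorted _ _)).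
  + by rewrite inE -rbc col_lt_size.
  + by rewrite inE col_lt_size.
  rewrite ltn_sub2r // (leq_ltn_trans _ lt_col) // -rbc.
  by case/andP: (box_col b).
- apply/forallP=> b; apply/forallP=> c; apply/implyP=> /andP[/eqP cbc lt_row].
  have [rb rc] : row b = 0 /\ row c = 1.
    by move: (row_lt2 c) lt_row; case: (row b) (row c) => [|?] [|[|]].
  rewrite !entry_tableau_of rb rc /= subn0.
  have := box_col b; have := box_col c; rewrite rb rc -cbc /=.
  move=> ltm /andP[ler _].
  have /latticeP/(_ (col b)) := lat_w; rewrite ler size_places bot_w ltm.
  by case.
apply/forallP=> v; apply/implyP=> v_gt0; have := ltn_ord v.
rewrite ltnS => lev.
have [|b eq_v] := @word_has_entry v.
  by rewrite v_gt0 -max_entry_tableau_of.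
by apply/existsP; exists b; apply/eqP.
Qed.

Lemma tableau_ofK N : size w = N -> word_of N T = w :> seq letter.
Proof.
move=> eqN; apply: (@eq_from_nth _ U); first by rewrite size_tuple.
move=> i; rewrite size_tuple => lti.
rewrite nth_word_of // /letter_of !occurs_tableau_of //.
rewrite !mem_places eqN; try lia.
by rewrite subKn 1?ltnW //; case: nth => [[]|].
Qed.

Lemma maj_tableau_of : maj T = wmaj w.
Proof.
rewrite /maj max_entry_tableau_of wmajE; apply: eq_bigl => i.
rewrite -(@occurs_tableau_of 0) // -(@occurs_tableau_of 1) //.
apply/existsP/andP=> [[b /existsP[c /and3P[/eqP eb /eqP ec lt_row]]]|[]].
  have [rb rc] : row b = 0 /\ row c = 1.
    by move: (row_lt2 c) lt_row; case: (row b) (row c) => [|?] [|[|]].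
  by split; apply/occursP; [exists b | exists c].
case/occursP=> b rb eb /occursP[c rc ec]; exists b; apply/existsP; exists c.
by rewrite eb ec rb rc !eqxx.
Qed.

End FromWord.

End TwoRows.

(** * From tableaux to words *)

Lemma sum_Inc (F : fieldType) (q : F) r a b k : (b <= a + r)%N ->
  \sum_(T in Inc [:: (a + k + r)%N; (b + k)%N] [:: r] k) q ^+ maj T =
  ballot_sum q r (a + b + k) a b k.
Proof.
move=> leb; set n := (a + k + r)%N; set m := (b + k)%N.
have le_mn : (m <= n)%N by rewrite /m /n addnAC leq_add2r.
have le_rn : (r <= n)%N by rewrite leq_addl.
have N_E : (n - r + m - k = a + b + k)%N by rewrite /n /m; lia.
pose N := (a + b + k)%N.
rewrite (reindex_onto (fun w : N.-tuple letter => tableau_of n m r w)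
           (@word_of n m r N)) /=; last first.
  by move=> T incT; rewrite /N -N_E word_ofK.
(* Given the length [N], the two row lengths determine the numbers of U's, D's and X's. *)
have shapeP (w : N.-tuple letter) : reflect
    [/\ lattice r w, count in_top w = n - r & count in_bot w = m]%N
    (ballot r a b k w).
  have := size_letters w; rewrite size_tuple.
  have := (count_top w, count_bot w) => -[-> ->] sz.
  apply: (iffP and4P) => [[-> /eqP -> /eqP -> /eqP ->]|[-> top_w bot_w]].
    by split=> //; rewrite /n /m; lia.
  by split=> //; apply/eqP; rewrite /N /n /m in sz top_w bot_w *; lia.
have sz (w : N.-tuple letter) : (size w + k = n - r + m)%N.
  by rewrite size_tuple /N /n /m; lia.
have word_ofP T : T \in Inc [:: n; m] [:: r] k ->
    [/\ lattice r (word_of N T), count in_top (word_of N T) = n - r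
      & count in_bot (word_of N T) = m]%N.
  move=> incT; rewrite /N -N_E.
  have [top_T bot_T] := count_word_of le_mn le_rn incT.
  by split=> //; apply: lattice_word_of.
(* The index set produced by the reindexing is exactly the set of ballot words. *)
have inE' (w : N.-tuple letter) :
    (tableau_of n m r w \in Inc [:: n; m] [:: r] k)
    && (word_of N (tableau_of n m r w) == w) = ballot r a b k w.
  apply/andP/shapeP => [[incT /eqP <-]|[lat_w top_w bot_w]].
    exact: word_ofP.
  split; first by apply: tableau_of_Inc.
  apply/eqP/val_inj.
  exact (tableau_ofK le_mn le_rn lat_w top_w bot_w (sz w) (size_tuple w)).
rewrite (eq_bigl _ _ inE'); apply: eq_bigr => w /shapeP[lat_w top_w bot_w].
by rewrite (@maj_tableau_of n m r k) // sz.
Qed.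

(** The word of any tableau has exactly [k] letters X, which lie in both rows; hence [k <= n - r]
    and [k <= m], and the subtractions in the witnesses are exact. The bound [b <= a + r] restates
    [m <= n]. *)
Lemma Inc_params r n m k : (m <= n)%N -> (r <= n)%N ->
  Inc [:: n; m] [:: r] k != set0 ->
  exists a b, [/\ n = a + k + r, m = b + k & b <= a + r]%N.
Proof.
move=> le_mn le_rn /set0Pn[T incT].
have le_k := Inc_max_entry le_mn incT.
have [] := count_word_of le_mn le_rn incT.
have := size_letters (word_of (n - r + m - k) T); rewrite size_tuple.
rewrite count_top count_bot => sz top_w bot_w.
exists (n - r - k)%N, (m - k)%N; split; lia.
Qed.

(** * From $q$-trinomials to the $q$-binomials of the theorem *)

Section QBinomial.
Variables (F : fieldType) (q : F).
Hypothesis q_generic : forall i, (0 < i)%N -> q ^+ i != 1.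

Lemma subr1_neq0 : 1 - q != 0.
Proof. by rewrite -[q]expr1 subr1X_neq0. Qed.

Lemma qfactE n : qfact q n = qpoch q n / (1 - q) ^+ n.
Proof.
rewrite /qfact /qpoch big_add1 /= big_mkord.
by rewrite prodf_div prodr_const card_ord.
Qed.

Lemma qbinomE a b : qbinom q (a + b)%N%:Z b%:Z =
  qpoch q (a + b) / (qpoch q a * qpoch q b).
Proof.
rewrite /qbinom lez_nat leq_addl /= PoszD addrK !absz_nat !qfactE exprD.
have q1 := subr1_neq0.
have := (qpoch_neq0 q_generic a, qpoch_neq0 q_generic b) => -[a0 b0].
by field; rewrite a0 b0 !expf_neq0.
Qed.

Lemma qbinom_gt (a b : int) : a < b -> qbinom q a b = 0.
Proof. by rewrite /qbinom ltNge => /negbTE ->; rewrite andbF. Qed.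

(** Each product of two $q$-binomials is a $q$-trinomial. With $n = s+k$ and $m-r = c+k$, the
    bracket in [bad_gf] is the fraction $(q^n[k]+[n][m-r])/([n][n+1])$ split over its two
    denominators. *)
Lemma ballot_gf_qbinom r a b k : (0 < a + k + r)%N ->
  q ^+ ((k * (k - 1)) %/ 2)%N
  * qbinom q ((a + k + r)%N%:Z + (b + k)%N%:Z - k%:Z - r%:Z) k%:Z
  * (qbinom q ((a + k + r)%N%:Z + (b + k)%N%:Z - 2 * k%:Z - r%:Z)
              ((b + k)%N%:Z - k%:Z)
     - (q ^+ (a + k + r) * qint q k%:Z
          + qint q (a + k + r)%N%:Z * qint q ((b + k)%N%:Z - r%:Z))
         / (qint q (a + k + r)%N%:Z * qint q ((a + k + r)%N%:Z + 1))
       * qbinom q ((a + k + r)%N%:Z + (b + k)%N%:Z - 2 * k%:Z - r%:Z)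
                  ((a + k + r)%N%:Z - k%:Z))
  = ballot_gf q r a b k.
Proof.
move=> n_gt0.
have -> : (a + k + r)%N%:Z + (b + k)%N%:Z - k%:Z - r%:Z
  = (a + b + k)%N%:Z by lia.
have -> : (a + k + r)%N%:Z + (b + k)%N%:Z - 2 * k%:Z - r%:Z
  = (a + b)%N%:Z by lia.
have -> : (b + k)%N%:Z - k%:Z = b%:Z by lia.
have -> : (a + k + r)%N%:Z - k%:Z = (a + r)%N%:Z by lia.
have -> : (a + k + r)%N%:Z + 1 = (a + k + r).+1%:Z by lia.
rewrite !qbinomE subn1 divn2 -bin2.
have pn0 := qpoch_neq0 q_generic.
have nz := subr1X_neq0 q_generic.
have q1 := subr1_neq0.
rewrite /ballot_gf /free_gf /qtrinom -/(qtri q k).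
(* For [b < r] the lower index [a + r] of the second $q$-binomial exceeds [a + b], so it vanishes,
   just as the correction is absent from [ballot_gf]. *)
case: (leqP r b) => [lerb|ltbr]; last first.
  rewrite (@qbinom_gt (a + b)%N); last by lia.
  rewrite mulr0 !subr0; field.
  by rewrite !pn0.
have -> : (b + k)%N%:Z - r%:Z = (b - r + k)%N%:Z by lia.
have -> : (a + b)%N%:Z = (b - r + (a + r))%N%:Z by lia.
rewrite qbinomE /bad_gf /qtrinom.
have -> : (b - r + (a + r) = a + b)%N by lia.
have -> : (a + r + (b - r) + k = a + b + k)%N by lia.
have n0 := nz _ n_gt0; have n1 := nz _ (ltn0Sn (a + k + r)).
rewrite addnAC in n0 n1 *.
rewrite /qint -!exprnP.
have := (pn0 a, pn0 b, pn0 k, pn0 (a + b)%N, pn0 (a + r)%N, pn0 (b - r)%N).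
move=> [] [] [] [] [] p1 p2 p3 p4 p5 p6.
move: n0 n1; rewrite !exprS !exprD => n0 n1.
by field; rewrite ?p1 ?p2 ?p3 ?p4 ?p5 ?p6 ?q1 ?n0 ?n1.
Qed.

End QBinomial.

(** As polynomials, $X^i$ and 1 have different sizes. *)
Lemma qX_generic i : (0 < i)%N -> qX ^+ i != 1.
Proof.
move=> i_gt0; rewrite /qX -rmorphXn /= -tofrac1 tofrac_eq.
apply/eqP => /(congr1 (fun p : {poly rat} => size p)) /eqP.
by rewrite size_polyXn size_poly1 eqSS gtn_eqF.
Qed.

Theorem theorem1p3 (r n m k : nat)
    (r_gt0 : (0 < r)%N) (n_gt0 : (0 < n)%N) (m_gt0 : (0 < m)%N)
    (k_gt0 : (0 < k)%N) (le_mn : (m <= n)%N) (le_rn : (r <= n)%N)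
    (Inc_neq0 : Inc [:: n; m] [:: r] k != set0) :
  \sum_(T in Inc [:: n; m] [:: r] k) qX ^+ maj T =
  qX ^+ ((k * (k - 1)) %/ 2)%N
  * qbinom qX (n%:Z + m%:Z - k%:Z - r%:Z) k%:Z
  * (qbinom qX (n%:Z + m%:Z - 2 * k%:Z - r%:Z) (m%:Z - k%:Z)
     - (qX ^+ n * qint qX k%:Z + qint qX n%:Z * qint qX (m%:Z - r%:Z))
         / (qint qX n%:Z * qint qX (n%:Z + 1))
       * qbinom qX (n%:Z + m%:Z - 2 * k%:Z - r%:Z) (n%:Z - k%:Z)).
Proof.
have [a [b [eq_n eq_m le_b]]] := Inc_params le_mn le_rn Inc_neq0.
rewrite {}eq_n {}eq_m in n_gt0 {m_gt0 le_mn le_rn Inc_neq0} *.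
rewrite sum_Inc // (ballot_gf_qbinom qX_generic) //.
rewrite addnC in le_b.
exact: (proj1 (ballot_sumE qX_generic r_gt0 (erefl (a + b + k)%N) le_b)).
Qed.
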